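(* Let $u,v\in S_n$ and let $\mathbf a=(a_1,\dots,a_{n-1})\in[n]^{n-1}$ satisfy $u\leq_{\mathbf a}v$. Then $$\mathcal T_{u,v,\mathbf a}=\bigcap_{k=1}^{n-1}\pi_k^{-1}\bigl(\mathcal R_{u[k],v[k],a_k}\bigr)\quad\text{and}\quad \mathcal T^\circ_{u,v,\mathbf a}=\bigcap_{k=1}^{n-1}\pi_k^{-1}\bigl(\mathcal R^\circ_{u[k],v[k],a_k}\bigr).$$
   Context: $[n]=\{1,\dots,n\}$; $\mathrm{Fl}_n$ is the variety of complete flags $F_\bullet=(0=F_0\subsetneq F_1\subsetneq\cdots\subsetneq F_n=\mathbb C^n)$; $\mathrm{Gr}(k,n)$ is the Grassmannian of $k$-dimensional subspaces of $\mathbb C^n$; $\pi_k:\mathrm{Fl}_n\to\mathrm{Gr}(k,n)$, $F_\bullet\mapsto F_k$. For $w\in S_n$, $w[k]:=\{w(1),\dots,w(k)\}$. For $S\subset[n]$, $\mathrm{Proj}_S:\mathbb C^n\to\mathbb C^{|S|}$ is the projection onto the coordinates indexed by $S$. Shifted orders: for $r\in[n]$, $\leq_r$ is the linear order $r<_r r+1<_r\cdots<_r n<_r1<_r\cdots<_r r-1$ on $[n]$; for $A=\{a_1<_r\cdots<_r a_k\}$, $B=\{b_1<_r\cdots<_r b_k\}$, $A\leq_r B$ iff $a_i\leq_r b_i$ for all $i$. Write $u\leq_{\mathbf a}v$ if $u[k]\leq_{a_k}v[k]$ for all $k\in[n-1]$. Cyclic intervals: $[a,b]_c=\{a,a+1,\dots,b\}$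 if $1\le a\leq b\le n$; $[a,b]_c=\{a,\dots,n\}\cup\{1,\dots,b\}$ if $a>b\ge 1$; $[a,0]_c=\{a,\dots,n\}$. Tilted Richardson varieties with respect to $\mathbf a$: $\mathcal T_{u,v,\mathbf a}$ is the set of $F_\bullet\in\mathrm{Fl}_n$ such that for all $i\in[n-1]$, $j\in[n]$: $\dim(\mathrm{Proj}_{[a_i,j]_c}(F_i))\leq\#(u[i]\cap[a_i,j]_c)$ and $\dim(\mathrm{Proj}_{[j,a_i-1]_c}(F_i))\leq\#(v[i]\cap[j,a_i-1]_c)$. The open version $\mathcal T^\circ_{u,v,\mathbf a}$ is defined by the same conditions with both $\leq$ replaced by $=$. Grassmannian Richardson varieties: for $I\in\binom{[n]}k$, $X_I=\{V\in\mathrm{Gr}(k,n):\dim\mathrm{Proj}_{[n-j+1,n]}(V)\leq\#(I\cap[n-j+1,n])\ \forall j\in[n]\}$ and $\Omega_I=\{V:\dim\mathrm{Proj}_{[j]}(V)\leq\#(I\cap[j])\ \forall j\in[n]\}$; $X_I^\circ,\Omega_I^\circ$ are defined with $=$ in place of $\leq$. For $I\leq J$ in the Gale order ($\leq_1$), $\mathcal R_{I,J}=X_J\cap\Omega_I$ and $\mathcal R_{I,J}^\circ=X_J^\circ\cap\Omega_I^\circ$. Cyclic rotation: $\chi:\mathrm{Gr}(k,n)\to\mathrm{Gr}(k,n)$ sends the column span of an $n\times k$ matrix with rows $\vec v_1,\dots,\vec v_n$ to the column span of the matrix with rows $\vec v_n,\vec v_1,\dots,\vec v_{n-1}$; for $I=\{i_1,\dots,i_k\}\subset[n]$,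 $\chi(I)=\{i_1+1,\dots,i_k+1\}$ with $n+1$ identified with $1$. For $I\leq_r J$, the cyclically rotated Grassmannian Richardson varieties are $\mathcal R_{I,J,r}:=\chi^{r-1}(\mathcal R_{\chi^{1-r}(I),\chi^{1-r}(J)})$ and $\mathcal R^\circ_{I,J,r}:=\chi^{r-1}(\mathcal R^\circ_{\chi^{1-r}(I),\chi^{1-r}(J)})$. *)

(* Defs.v *)
From mathcomp Require Import all_boot all_order all_fingroup all_algebra.
From mathcomp Require Import classical_sets.

Set Implicit Arguments.
Unset Strict Implicit.
Unset Printing Implicit Defensive.

Import GRing.Theory.

Local Open Scope nat_scope.

(* The index set [n] = {1, ..., n} is represented by 'I_n: the ordinal x
   stands for the element label x = x + 1.  Numerical formulas below are
   written with the 1-based labels.  Likewise [n-1] is 'I_n.-1. *)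
Definition label n (x : 'I_n) : nat := x.+1.

(* w[k] = {w(1), ..., w(k)} *)
Definition initial n (w : 'S_n) (k : nat) : {set 'I_n} :=
  w @: [set x : 'I_n | label x <= k]%SET.

(* The whole of [n] in increasing order for <_r, that is
   r, r+1, ..., n, 1, ..., r-1. *)
Definition shifted_enum n (r : 'I_n) : seq 'I_n := rot r (enum 'I_n).

Definition shifted_le n (r x y : 'I_n) : bool :=
  index x (shifted_enum r) <= index y (shifted_enum r).

(* The elements a_1 <_r ... <_r a_k of A. *)
Definition shifted_sort n (r : 'I_n) (A : {set 'I_n}) : seq 'I_n :=
  [seq x <- shifted_enum r | x \in A].

(* A <=_r B; all2 also requires #|A| = #|B|. *)
Definition shifted_gale n (r : 'I_n) (A B : {set 'I_n}) : bool :=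
  all2 (shifted_le r) (shifted_sort r A) (shifted_sort r B).

Definition tilted_le n (a : n.-1.-tuple 'I_n) (u v : 'S_n) : bool :=
  [forall k : 'I_n.-1,
     shifted_gale (tnth a k) (initial u (label k)) (initial v (label k))].

Definition interval n (a b : nat) : {set 'I_n} :=
  [set x : 'I_n | a <= label x <= b]%SET.

(* [a,b]_c for a >= 1; the convention [a,0]_c = {a, ..., n} is the instance
   b = 0 of the second branch. *)
Definition cyclic_interval n (a b : nat) : {set 'I_n} :=
  if a <= b then interval n a b else interval n a n :|: interval n 1 b.

Definition chi_set n (I : {set 'I_n}) : {set 'I_n} := @ordS n @: I.
Definition chi_set_inv n (I : {set 'I_n}) : {set 'I_n} := @ord_pred n @: I.

Lemma chi_setK n : cancel (@chi_set n) (@chi_set_inv n).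
Proof.
move=> I; rewrite /chi_set /chi_set_inv -imset_comp -[RHS]imset_id.
by apply: eq_imset => x /=; rewrite ordSK.
Qed.

Lemma chi_set_invK n : cancel (@chi_set_inv n) (@chi_set n).
Proof.
move=> I; rewrite /chi_set /chi_set_inv -imset_comp -[RHS]imset_id.
by apply: eq_imset => x /=; rewrite ord_predK.
Qed.

Section Geometry.
Variables (F : fieldType) (n : nat).
Local Notation space := {vspace 'cV[F]_n}.

(* Proj_S : F^n -> F^|S|, keeping the coordinates indexed by S *)
Definition Proj (S : {set 'I_n}) : 'Hom('cV[F]_n, 'cV[F]_#|S|) :=
  linfun (rowsub (fun i : 'I_#|S| => enum_val i)).

Lemma ProjE S (x : 'cV[F]_n) i : Proj S x i ord0 = x (enum_val i) ord0.
Proof. by rewrite lfunE /= mxE. Qed.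

Record Gr (k : nat) := MkGr { gr_space :> space; _ : \dim gr_space == k }.

Lemma gr_inj k : injective (@gr_space k).
Proof.
by case=> U hU [V hV] /= UV; rewrite UV in hU *; rewrite (eq_irrelevance hU hV).
Qed.

Lemma dim_gr k (V : Gr k) : \dim V = k.
Proof. by case: V => V /= /eqP. Qed.

Record flag := Flag {
  flag_space :> {ffun 'I_n.+1 -> space};
  flag_bot : flag_space ord0 = 0%VS;
  flag_top : flag_space ord_max = fullv;
  flag_le : forall i j : 'I_n.+1, i.+1 = j :> nat ->
              (flag_space i <= flag_space j)%VS;
  flag_neq : forall i j : 'I_n.+1, i.+1 = j :> nat ->
              flag_space i <> flag_space j
}.

Lemma flag_dim_lt (Fl : flag) (i j : 'I_n.+1) :
  i.+1 = j :> nat -> \dim (Fl i) < \dim (Fl j).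
Proof.
move=> ij; rewrite ltnNge; apply/negP => le_ji.
by apply: (flag_neq (f := Fl) ij); apply/eqP; rewrite eqEdim (flag_le Fl ij).
Qed.

Lemma dim_flag (Fl : flag) (k : 'I_n.+1) : \dim (Fl k) == k.
Proof.
have lo m (i : 'I_n.+1) : i = m :> nat -> m <= \dim (Fl i).
  elim: m i => // m IH i im.
  have lt_m : m < n.+1 by rewrite -ltnS -im ltnW // ltnS ltn_ord.
  apply: leq_ltn_trans (IH (Ordinal lt_m) erefl) _.
  by apply: flag_dim_lt; rewrite im.
have hi m (i : 'I_n.+1) : i + m = n -> \dim (Fl i) + m <= n.
  elim: m i => [|m IH] i im.
    have -> : i = ord_max by apply: val_inj => /=; rewrite -[RHS]im addn0.
    by rewrite (flag_top Fl) dimvf dim_matrix addn0 -[X in _ <= X]muln1.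
  have lt_i : i.+1 < n.+1 by rewrite ltnS -[X in _ <= X]im -addSnnS leq_addr.
  rewrite addnS -addSn.
  apply: leq_trans (IH (Ordinal lt_i) _); last by rewrite /= addSn -addnS.
  by rewrite leq_add2r; apply: flag_dim_lt.
have le_kn : k <= n by rewrite -ltnS.
have := hi (n - k) k (subnKC le_kn).
rewrite -[X in _ <= X](subnKC le_kn) leq_add2r => le_dk.
by rewrite eqn_leq le_dk lo.
Qed.

Definition flag_proj (k : 'I_n.+1) (Fl : flag) : Gr k := MkGr (dim_flag Fl k).

Definition colspan k (A : 'M[F]_(n, k)) : space :=
  <<[seq col j A | j : 'I_k]>>%VS.

(* The rows v_1, ..., v_n of A become v_n, v_1, ..., v_(n-1). *)
Definition rotate_rows k (A : 'M[F]_(n, k)) : 'M[F]_(n, k) :=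
  rowsub (@ord_pred n) A.

Definition basis_matrix (V : space) : 'M[F]_(n, \dim V) :=
  \matrix_(i, j) tnth (vbasis V) j i ord0.

(* Independent of the choice of the matrix by chi_space_colspan below. *)
Definition chi_space (V : space) : space :=
  colspan (rotate_rows (basis_matrix V)).

Definition rotation : 'Hom('cV[F]_n, 'cV[F]_n) :=
  linfun (rowsub (@ord_pred n)).

Lemma colspan_rotate k (A : 'M[F]_(n, k)) :
  colspan (rotate_rows A) = (rotation @: colspan A)%VS.
Proof.
rewrite /colspan limg_span -map_comp; congr <<_>>%VS; apply: eq_map => j /=.
by rewrite /rotation lfunE /=; apply/colP => i; rewrite !mxE.
Qed.

Lemma basis_matrixK (V : space) : colspan (basis_matrix V) = V.
Proof.
rewrite -[RHS](span_basis (vbasisP V)); congr <<_>>%VS.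
apply: (@eq_from_nth _ 0%R).
  by rewrite size_map -cardE card_ord size_tuple.
move=> j; rewrite size_map -cardE card_ord => lt_j.
rewrite (nth_map (Ordinal lt_j)) -?cardE ?card_ord //.
by apply/colP => i; rewrite !mxE (tnth_nth 0%R) nth_enum_ord.
Qed.

Lemma chi_spaceE (V : space) :
  chi_space V = (rotation @: V)%VS.
Proof. by rewrite /chi_space colspan_rotate basis_matrixK. Qed.

Lemma chi_space_colspan k (A : 'M[F]_(n, k)) :
  chi_space (colspan A) = colspan (rotate_rows A).
Proof. by rewrite chi_spaceE colspan_rotate. Qed.

Lemma dim_chi_space k (V : Gr k) : \dim (chi_space V) == k.
Proof.
rewrite chi_spaceE limg_dim_eq ?dim_gr //.
suff -> : lker rotation = 0%VS by rewrite capv0.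
apply/eqP/lker0P => x y; rewrite /rotation !lfunE /= => /colP xy.
by apply/colP => i; have := xy (ordS i); rewrite !mxE ordSK.
Qed.

Definition chi k (V : Gr k) : Gr k := MkGr (dim_chi_space V).

(* The index sets I and J are meant to be k-element subsets, with I <= J in
   the (rotated) Gale order. *)

Section Richardson.
Variable k : nat.
Implicit Types (I J : {set 'I_n}) (V : Gr k).

Definition schubX I : set (Gr k) := [set V | forall j, 1 <= j <= n ->
  \dim (Proj (interval n (n - j + 1) n) @: V)
    <= #|I :&: interval n (n - j + 1) n|]%classic.

Definition schubOmega I : set (Gr k) := [set V | forall j, 1 <= j <= n ->
  \dim (Proj (interval n 1 j) @: V) <= #|I :&: interval n 1 j|]%classic.

Definition schubXo I : set (Gr k) := [set V | forall j, 1 <= j <= n ->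
  \dim (Proj (interval n (n - j + 1) n) @: V)
    = #|I :&: interval n (n - j + 1) n|]%classic.

Definition schubOmegao I : set (Gr k) := [set V | forall j, 1 <= j <= n ->
  \dim (Proj (interval n 1 j) @: V) = #|I :&: interval n 1 j|]%classic.

Definition Rich I J : set (Gr k) := (schubX J `&` schubOmega I)%classic.
Definition Richo I J : set (Gr k) := (schubXo J `&` schubOmegao I)%classic.

(* chi^(l-1) of a Richardson variety of chi^(1-l)(I) and chi^(1-l)(J), where
   l = label r; the exponent l - 1 is the natural number underlying r. *)
Definition rotRich I J (r : 'I_n) : set (Gr k) :=
  (iter r (@chi k)
     @` Rich (iter r (@chi_set_inv n) I) (iter r (@chi_set_inv n) J))%classic.

Definition rotRicho I J (r : 'I_n) : set (Gr k) :=
  (iter r (@chi k)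
     @` Richo (iter r (@chi_set_inv n) I) (iter r (@chi_set_inv n) J))%classic.

End Richardson.

Fact step_subproof (k : 'I_n.-1) : label k < n.+1.
Proof. by rewrite /label ltnS (leq_trans (ltn_ord k)) ?leq_pred. Qed.

(* The element of [n-1] with label k, viewed in {0, ..., n}. *)
Definition step (k : 'I_n.-1) : 'I_n.+1 := Ordinal (step_subproof k).

Definition tilted (u v : 'S_n) (a : n.-1.-tuple 'I_n) : set flag :=
  [set Fl : flag | forall (i : 'I_n.-1) (j : nat), 1 <= j <= n ->
     let ai := label (tnth a i) in
     \dim (Proj (cyclic_interval n ai j) @: Fl (step i))
       <= #|initial u (label i) :&: cyclic_interval n ai j|
     /\ \dim (Proj (cyclic_interval n j (ai - 1)) @: Fl (step i))
       <= #|initial v (label i) :&: cyclic_interval n j (ai - 1)|]%classic.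

Definition tiltedo (u v : 'S_n) (a : n.-1.-tuple 'I_n) : set flag :=
  [set Fl : flag | forall (i : 'I_n.-1) (j : nat), 1 <= j <= n ->
     let ai := label (tnth a i) in
     \dim (Proj (cyclic_interval n ai j) @: Fl (step i))
       = #|initial u (label i) :&: cyclic_interval n ai j|
     /\ \dim (Proj (cyclic_interval n j (ai - 1)) @: Fl (step i))
       = #|initial v (label i) :&: cyclic_interval n j (ai - 1)|]%classic.

End Geometry.

Arguments tilted F {n} u v a.
Arguments tiltedo F {n} u v a.

(* Main.v *)
Require Import Defs.
From mathcomp Require Import all_boot all_order all_fingroup all_algebra.
From mathcomp Require Import reals classical_sets complex.
From mathcomp Require Import zify.

Set Implicit Arguments.
Unset Strict Implicit.

Local Open Scope classical_set_scope.

(** The conditions at different steps of the flag do not interact, so the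
    equalities hold one [k] at a time: a [k]-plane [V] satisfies the tilted
    rank conditions at [k] exactly when it lies in the rotated Richardson
    variety.  Write [V] as the [r]-fold rotation of a [k]-plane [W], which is
    possible because the rotation of the Grassmannian is onto.  The
    coordinates of [V] in [S] are those of [W] in the set obtained by rotating
    [S] back [r] times, so the two projections have equal rank
    ([dim_Proj_iter_chi]); cardinalities are unchanged when both sets are
    rotated back ([card_iter_chi_set_inv]).  Finally the [r]-fold rotation
    carries the initial intervals of 1, ..., n to the cyclic intervals
    starting at [r + 1], and the final ones to the cyclic intervals ending at
    [r] ([iter_chi_initial_interval], [iter_chi_final_interval]), and each
    nonempty cyclic interval of these two kinds arises.  So the Richardson
    conditions on [W] are the tilted conditions on [V], reindexed.  As only
    the pairs of numbers being compared matter, the argument is carried out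
    for an arbitrary comparison [c], and serves for both the closed and the
    open varieties. *)

Lemma mem_chi_set n (S : {set 'I_n}) x :
  (x \in chi_set S) = (ord_pred x \in S).
Proof. by rewrite -{1}(ord_predK x) mem_imset //; apply: can_inj (@ordSK n). Qed.

Lemma mem_chi_set_inv n (S : {set 'I_n}) x :
  (x \in chi_set_inv S) = (ordS x \in S).
Proof.
by rewrite -{1}(ordSK x) mem_imset //; apply: can_inj (@ord_predK n).
Qed.

Lemma mem_iter_chi_set n r (S : {set 'I_n}) x :
  (x \in iter r (@chi_set n) S) = (iter r (@ord_pred n) x \in S).
Proof. by elim: r x => //= r IH x; rewrite mem_chi_set IH -iterSr. Qed.

Lemma iter_chi_setK n r :
  cancel (iter r (@chi_set n)) (iter r (@chi_set_inv n)).
Proof. by elim: r => // r IH S; rewrite iterSr iterS chi_setK IH. Qed.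

Lemma card_iter_chi_set_inv n r (I S : {set 'I_n}) :
  #|iter r (@chi_set_inv n) I :&: iter r (@chi_set_inv n) S| = #|I :&: S|.
Proof.
elim: r => //= r <-; have inj := can_inj (@ord_predK n).
by rewrite /chi_set_inv -imsetI ?card_imset // => x y _ _; apply: inj.
Qed.

Lemma val_ord_pred n (x : 'I_n) :
  ord_pred x = (if x == 0 :> nat then n.-1 else x.-1) :> nat.
Proof.
have lt_x := ltn_ord x; rewrite /=; case: eqP => [->|x0].
  by rewrite add0n modn_small //; lia.
have -> : (x + n).-1 = x.-1 + n by lia.
by rewrite modnDr modn_small //; lia.
Qed.

Lemma val_iter_ord_pred n r (x : 'I_n) : r <= n ->
  iter r (@ord_pred n) x = (if x < r then x + n - r else x - r) :> nat.
Proof.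
elim: r => [|r IH] le_rn; first by rewrite /= subn0.
have lt_x := ltn_ord x.
rewrite iterS val_ord_pred (IH (ltnW le_rn)).
by case: (ltnP x r) => ?; repeat case: ifP => ?; lia.
Qed.

(** Addition modulo [n] with representatives 1, ..., [n]. *)
Definition rotate_label n r m := if r + m <= n then r + m else r + m - n.

Lemma rotate_label_bounds n r m : r < n -> 1 <= m <= n ->
  1 <= rotate_label n r m <= n.
Proof. by rewrite /rotate_label; case: ifP; lia. Qed.

Lemma rotate_label_onto n r j : r < n -> 1 <= j <= n ->
  exists2 m, 1 <= m <= n & rotate_label n r m = j.
Proof.
move=> lt_rn j_n; rewrite /rotate_label.
by case: (ltnP r j) => ?; [exists (j - r) | exists (j + n - r)];
  try case: ifP => ?; lia.
Qed.

Lemma iter_chi_initial_interval n r l : r < n -> 1 <= l <= n ->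
  iter r (@chi_set n) (Defs.interval n 1 l)
    = cyclic_interval n r.+1 (rotate_label n r l).
Proof.
move=> lt_rn l_n; apply/setP => x; have lt_x := ltn_ord x.
rewrite mem_iter_chi_set !inE /label (val_iter_ord_pred x (ltnW lt_rn)).
rewrite /cyclic_interval /rotate_label.
by case: (leqP (r + l) n) => ?; case: (ltnP x r) => ?; case: ifP => ?;
  rewrite !inE /label; lia.
Qed.

(** When [r] is 0, this relies on the convention for cyclic intervals ending at
    0, which run up to [n]. *)
Lemma iter_chi_final_interval n r m : r < n -> 1 <= m <= n ->
  iter r (@chi_set n) (Defs.interval n m n)
    = cyclic_interval n (rotate_label n r m) r.
Proof.
move=> lt_rn m_n; apply/setP => x; have lt_x := ltn_ord x.
rewrite mem_iter_chi_set !inE /label (val_iter_ord_pred x (ltnW lt_rn)).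
rewrite /cyclic_interval /rotate_label.
by case: (leqP (r + m) n) => ?; case: (ltnP x r) => ?; case: ifP => ?;
  rewrite !inE /label; lia.
Qed.

Section Rotation.
Variables (F : fieldType) (n : nat).

Lemma eq_lker_dim_limg (uT vT wT : vectType F)
    (f : 'Hom(uT, vT)) (g : 'Hom(uT, wT)) (U : {vspace uT}) :
  lker f = lker g -> \dim (f @: U) = \dim (g @: U).
Proof.
move=> eq_ker; apply: (@addnI (\dim (U :&: lker f))).
by rewrite limg_ker_dim eq_ker limg_ker_dim.
Qed.

Lemma lker_Proj (S : {set 'I_n}) (x : 'cV[F]_n) :
  reflect (forall i, i \in S -> x i ord0 = 0%R) (x \in lker (Proj F S)).
Proof.
rewrite memv_ker; apply: (iffP eqP) => [/colP x0 i iS | x0].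
  by have := x0 (enum_rank_in iS i); rewrite ProjE mxE enum_rankK_in.
by apply/colP => i; rewrite ProjE mxE x0 // enum_valP.
Qed.

Lemma rotationE (x : 'cV[F]_n) i :
  rotation F n x i ord0 = x (ord_pred i) ord0.
Proof. by rewrite lfunE /= mxE. Qed.

(** Different coordinate spaces receive the two projections, but both ranks
    are determined by the kernels, and these agree. *)
Lemma dim_Proj_chi k (W : Gr F n k) (S : {set 'I_n}) :
  \dim (Proj F S @: chi W) = \dim (Proj F (chi_set_inv S) @: W).
Proof.
rewrite [gr_space (chi W)]chi_spaceE -limg_comp.
apply: eq_lker_dim_limg; apply/vspaceP => x.
rewrite memv_ker comp_lfunE -memv_ker.
apply/lker_Proj/lker_Proj => x0 i iS.
  have := x0 (ordS i); rewrite rotationE ordSK; apply.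
  by rewrite -mem_chi_set_inv.
by rewrite rotationE x0 // mem_chi_set_inv ord_predK.
Qed.

Lemma dim_Proj_iter_chi k r (W : Gr F n k) (S : {set 'I_n}) :
  \dim (Proj F S @: iter r (@chi F n k) W)
    = \dim (Proj F (iter r (@chi_set_inv n) S) @: W).
Proof. by elim: r S => // r IH S; rewrite iterS dim_Proj_chi IH -iterSr. Qed.

Lemma lker_rotation : lker (rotation F n) == 0%VS.
Proof.
apply/lker0P => x y /colP xy; apply/colP => i.
by have := xy (ordS i); rewrite !rotationE ordSK.
Qed.

Lemma chi_onto k (V : Gr F n k) : exists W, chi W = V.
Proof.
have inv_ker : lker (rotation F n)^-1%VF == 0%VS.
  apply/lker0P; apply: (can_inj (g := rotation F n)) => x.
  by rewrite -comp_lfunE lker0_compfV ?lker_rotation // id_lfunE.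
have dimW : \dim ((rotation F n)^-1 @: V) == k.
  by rewrite limg_dim_eq ?dim_gr // (eqP inv_ker) capv0.
exists (MkGr dimW); apply: gr_inj.
by rewrite [LHS]chi_spaceE -limg_comp lker0_compfV ?lker_rotation ?lim1g.
Qed.

Lemma iter_chi_onto k r (V : Gr F n k) : exists W, iter r (@chi F n k) W = V.
Proof.
elim: r V => [|r IH] V; first by exists V.
by have [W <-] := chi_onto V; have [W' <-] := IH W; exists W'.
Qed.

(** The set [T] plays the role of the [r]-fold rotation of an interval [S]:
    a rank condition on [W] along [S] is one on the rotated plane along [T]. *)
Lemma rank_condition_rotate (c : nat -> nat -> Prop) k r (W : Gr F n k)
    (I S T : {set 'I_n}) : iter r (@chi_set n) S = T ->
  c (\dim (Proj F S @: W)) #|iter r (@chi_set_inv n) I :&: S|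
  <-> c (\dim (Proj F T @: iter r (@chi F n k) W)) #|I :&: T|.
Proof.
move=> <-; rewrite dim_Proj_iter_chi -(card_iter_chi_set_inv r I).
by rewrite iter_chi_setK.
Qed.

Lemma rotated_rank_conditions (c : nat -> nat -> Prop) k (r : 'I_n)
    (I J : {set 'I_n}) (V : Gr F n k) :
  (exists2 W : Gr F n k,
     (forall j, 1 <= j <= n ->
        c (\dim (Proj F (Defs.interval n (n - j + 1) n) @: W))
          #|iter r (@chi_set_inv n) J :&: Defs.interval n (n - j + 1) n|)
     /\ (forall j, 1 <= j <= n ->
        c (\dim (Proj F (Defs.interval n 1 j) @: W))
          #|iter r (@chi_set_inv n) I :&: Defs.interval n 1 j|)
   & iter r (@chi F n k) W = V)
  <-> forall j, 1 <= j <= n ->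
        c (\dim (Proj F (cyclic_interval n (label r) j) @: V))
          #|I :&: cyclic_interval n (label r) j|
     /\ c (\dim (Proj F (cyclic_interval n j (label r - 1)) @: V))
          #|J :&: cyclic_interval n j (label r - 1)|.
Proof.
have lt_rn := ltn_ord r; rewrite /label subn1 /=; split.
  case=> W [cJ cI] <- j j_n.
  have [m m_n <-] := rotate_label_onto lt_rn j_n; split.
    apply/(rank_condition_rotate c W I (iter_chi_initial_interval lt_rn m_n)).
    exact: cI.
  apply/(rank_condition_rotate c W J (iter_chi_final_interval lt_rn m_n)).
  (* The final interval starting at m has length n - m + 1. *)
  have -> : m = n - (n - m + 1) + 1 by lia.
  by apply: cJ; lia.
have [W <-] := iter_chi_onto r V => cIJ; exists W => //; split=> j j_n.
  have m_n : 1 <= n - j + 1 <= n by lia.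
  apply/(rank_condition_rotate c W J (iter_chi_final_interval lt_rn m_n)).
  by have [] := cIJ _ (rotate_label_bounds lt_rn m_n).
apply/(rank_condition_rotate c W I (iter_chi_initial_interval lt_rn j_n)).
by have [] := cIJ _ (rotate_label_bounds lt_rn j_n).
Qed.

End Rotation.

Theorem theorem4p6 (R : realType) (n : nat) (u v : 'S_n)
    (a : n.-1.-tuple 'I_n) (huv : tilted_le a u v) :
  tilted R[i] u v a =
    \bigcap_(k in [set: 'I_n.-1]%classic)
      (flag_proj (step k) @^-1`
        rotRich (initial u (label k)) (initial v (label k)) (tnth a k))
  /\
  tiltedo R[i] u v a =
    \bigcap_(k in [set: 'I_n.-1]%classic)
      (flag_proj (step k) @^-1`
        rotRicho (initial u (label k)) (initial v (label k)) (tnth a k)).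
Proof.
pose V k (Fl : flag R[i] n) : Gr R[i] n (step k) := flag_proj (step k) Fl.
have conditions c k Fl := rotated_rank_conditions c (tnth a k)
  (initial u (label k)) (initial v (label k)) (V k Fl).
split; apply/seteqP; split=> Fl FlP.
- by move=> k _; apply/(conditions leq) => j j_n; apply: FlP.
- by move=> k; apply/(conditions leq k Fl)/FlP.
- by move=> k _; apply/(conditions eq) => j j_n; apply: FlP.
- by move=> k; apply/(conditions eq k Fl)/FlP.
Qed.
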